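(* For the standard signed $q$-Cartan matrices $A_u(B_n)$ and $A_u(C_n)=A_u(B_n)^T$ of types $B_n$ and $C_n$, set $\delta_n(u)=\det A_u(B_n)=\det A_u(C_n)$. Then, for $n\ge2$, $$\delta_n(u)=[2]_u\bigl([n]_u-[n-1]_u\bigr)=u^{-n}\,\frac{(u^2+1)(u^{2n-1}+1)}{u+1}.$$
   Context: For $m\in\mathbb Z$, $[m]_u=\frac{u^m-u^{-m}}{u-u^{-1}}$, viewed as a Laurent polynomial in $u$. Put $s=[2]_u=u+u^{-1}$. $A_u(B_n)$ is the $n\times n$ tridiagonal matrix with all diagonal entries equal to $s$, all superdiagonal and subdiagonal entries equal to $-1$ except that the entry in position $(n-1,n)$ is $-s$ (and the entry in position $(n,n-1)$ is $-1$), and all other entries $0$: $$A_u(B_n)=\begin{pmatrix}s&-1&&&\\-1&s&-1&&\\&\ddots&\ddots&\ddots&\\&&-1&s&-s\\&&&-1&s\end{pmatrix}.$$ That is, it is obtained from the Cartan matrix $(a_{ij})$ of type $B_n$, with $a_{n-1,n}=-2$ and $a_{n,n-1}=-1$, by replacing each entry $a_{ij}$ by $[a_{ij}]_u$. *)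

(* Defs.v *)
From HB Require Import structures.
From mathcomp Require Import all_boot all_order all_algebra fraction.
From mathcomp Require Import ring.

Set Implicit Arguments.
Unset Strict Implicit.
Unset Printing Implicit Defensive.

Import Order.TTheory GRing.Theory Num.Theory.
Local Open Scope ring_scope.

(* The Laurent polynomial ring Z[u, u^-1] is used through its embedding in    *)
(* its field of fractions Q(u), presented as the fraction field of Z[u]; the  *)
(* subring is the predicate [laurent].                                        *)
Definition Qu : fieldType := {fraction {poly int}}.

Definition u : Qu := tofrac 'X.

Definition laurent (f : Qu) : Prop :=
  exists (p : {poly int}) (k : nat), f = tofrac p * u ^- k.

Definition qint (m : int) : Qu := (u ^ m - u ^ (- m)) / (u - u^-1).

Definition qCartanB (n : nat) : 'M[Qu]_n :=
  \matrix_(i < n, j < n)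
    if i == j then qint 2
    else if i.+1 == j :> nat then (if j.+1 == n then - qint 2 else - 1)
    else if i == j.+1 :> nat then - 1
    else 0.

Definition qCartanC (n : nat) : 'M[Qu]_n := (qCartanB n)^T.

Definition cartanB (n : nat) : 'M[int]_n :=
  \matrix_(i < n, j < n)
    if i == j then 2
    else if i.+1 == j :> nat then (if j.+1 == n then - 2 else - 1)
    else if i == j.+1 :> nat then - 1
    else 0.

Lemma u_neq0 : u != 0.
Proof. by rewrite /u tofrac_eq0 polyX_eq0. Qed.

Lemma u2_neq1 : u ^+ 2 != 1.
Proof.
rewrite /u -tofracXn -tofrac1 tofrac_eq; apply/eqP => /(congr1 (coefp 0)).
by rewrite /coefp coefXn coef1.
Qed.

Lemma u_subV_neq0 : u - u^-1 != 0.
Proof.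
apply: contra u2_neq1; rewrite subr_eq0 => /eqP uV.
by rewrite expr2 {1}uV mulVf ?u_neq0.
Qed.

Lemma qint0 : qint 0 = 0.
Proof. by rewrite /qint oppr0 subrr mul0r. Qed.

Lemma qintN (m : int) : qint (- m) = - qint m.
Proof. by rewrite /qint opprK -mulNr opprB. Qed.

Lemma qint1 : qint 1 = 1.
Proof. by rewrite /qint expr1z exprN1 divff ?u_subV_neq0. Qed.

Lemma qintS_field (F : fieldType) (x : F) (n : nat) :
    x != 0 -> x - x^-1 != 0 ->
  (x ^ (n.+1 : int) - x ^ (- (n.+1 : int))) / (x - x^-1)
  = x * ((x ^ (n : int) - x ^ (- (n : int))) / (x - x^-1)) + x ^- n.
Proof.
move=> x0 xV; rewrite -!exprnN -!exprnP.
suff E : x ^+ n.+1 - x ^- n.+1 = x * (x ^+ n - x ^- n) + x ^- n * (x - x^-1).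
  by rewrite E mulrDl mulfK // mulrA.
rewrite !exprS; field.
by rewrite x0 expf_neq0.
Qed.

Lemma qintS (n : nat) : qint n.+1 = u * qint n + u ^- n.
Proof. exact: qintS_field u_neq0 u_subV_neq0. Qed.

Lemma qint2 : qint 2 = u + u^-1.
Proof. by rewrite (qintS 1) qint1 mulr1 expr1. Qed.

Lemma frac_step (F : fieldType) (x p : F) (k n : nat) : x != 0 ->
  x * (p * x ^- k) + x ^- n = (x ^+ n.+1 * p + x ^+ k) * x ^- (k + n).
Proof.
move=> x0; rewrite exprD exprS; field.
by rewrite !expf_neq0.
Qed.

Lemma qint_laurent (m : int) : laurent (qint m).
Proof.
have nat_case (n : nat) : laurent (qint n).
  elim: n => [|n [p [k E]]].
    by exists 0, 0%N; rewrite qint0 tofrac0 mul0r.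
  exists ('X ^+ n.+1 * p + 'X ^+ k), (k + n)%N.
  by rewrite qintS E tofracD tofracM !tofracXn (frac_step _ _ _ u_neq0).
case: (intP m) => [|n|n]; [exact: (nat_case 0%N) | exact: nat_case |].
have [p [k E]] := nat_case n.+1; exists (- p), k.
by rewrite qintN E tofracN mulNr.
Qed.

Lemma qCartanB_map (n : nat) : qCartanB n = map_mx qint (cartanB n).
Proof.
apply/matrixP => i j; rewrite !mxE.
by do ![case: ifP => _]; rewrite ?qintN ?qint1 ?qint0.
Qed.

(* Main.v *)
Require Import Defs.
From HB Require Import structures.
From mathcomp Require Import all_boot all_order all_algebra fraction.
From mathcomp Require Import ring.

Set Implicit Arguments.
Unset Strict Implicit.
Unset Printing Implicit Defensive.

Import Order.TTheory GRing.Theory Num.Theory.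
Local Open Scope ring_scope.

(** The irregular entry of the type B matrix sits at its lower right end, so
    deleting the first row and column turns [qCartanB n.+1] into [qCartanB n]
    ([qCartanB_minor]).  Laplace expansion of a tridiagonal matrix at its upper
    left corner ([det_tridiag_corner]) therefore gives
      delta_(n+3) = [2] delta_(n+2) - delta_(n+1),
    which is the three-term recurrence satisfied by the q-integers ([qintSS]),
    hence also by [2] ([n] - [n-1]).  The two sequences agree for n = 1, where
    both are [2], and for n = 2, where both are [2]^2 - [2]; so they agree for
    every n >= 1.  The product formula is then an identity of rational
    functions in u and u^n, and type C follows by transposition. *)

(** Expand along the first row; in the minor belonging to the entry (0, 1) the
    first column has a single nonzero entry, namely [A 1 0]. *)
Lemma det_tridiag_corner (R : comPzRingType) (n : nat) (A : 'M[R]_n.+2) :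
    (forall j : 'I_n.+2, (1 < j)%N -> A 0 j = 0) ->
    (forall i : 'I_n.+2, (1 < i)%N -> A i 0 = 0) ->
  \det A = A 0 0 * \det (row' 0 (col' 0 A))
         - A 0 1 * A 1 0 * \det (row' 0 (col' 0 (row' 0 (col' 0 A)))).
Proof.
move=> row0 col0; have lift01 : lift 0 0 = 1 :> 'I_n.+2 by apply/val_inj.
rewrite (expand_det_row A 0) 2!big_ord_recl big1 => [|j _]; last first.
  by rewrite row0 ?mul0r // !lift0.
rewrite addr0 lift01 /cofactor /= addn0 expr0 mul1r add0n expr1 mulN1r.
congr (_ + _); rewrite mulrN; congr (- _); rewrite -mulrA; congr (_ * _).
rewrite (expand_det_col _ 0) big_ord_recl big1 => [|i _]; last first.
  rewrite !mxE (_ : lift 1 0 = 0); last by apply/val_inj.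
  by rewrite col0 ?mul0r // !lift0.
rewrite addr0 /cofactor addn0 expr0 mul1r !mxE lift01.
rewrite (_ : lift 1 0 = 0); last by apply/val_inj.
congr (_ * \det _); apply/matrixP => i j; rewrite !mxE.
by congr (A _ _); apply/val_inj.
Qed.

Lemma qCartanB_minor (n : nat) :
  row' 0 (col' 0 (qCartanB n.+1)) = qCartanB n.
Proof.
apply/matrixP => i j; rewrite !mxE.
by rewrite (inj_eq lift_inj) !lift0 !eqSS.
Qed.

Lemma det_qCartanB1 : \det (qCartanB 1) = qint 2.
Proof. by rewrite det_mx11 mxE. Qed.

(** The case distinction is there because the corner entries in positions
    (0, 1) and (1, 0) have product 1, except in the 2 x 2 matrix, where the
    position (0, 1) is the one carrying [- qint 2]. *)
Lemma det_qCartanB_corner (n : nat) :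
  \det (qCartanB n.+2) = qint 2 * \det (qCartanB n.+1)
    - (if n == 0%N then qint 2 else 1) * \det (qCartanB n).
Proof.
rewrite det_tridiag_corner.
- rewrite !qCartanB_minor !mxE /= !eqSS eq_sym.
  by case: (n == 0%N); rewrite mulrN1 opprK.
- by case=> [[|[|j]] lt_j] //= _; rewrite mxE.
- by case=> [[|[|i]] lt_i] //= _; rewrite mxE.
Qed.

Lemma qint_rec_field (F : fieldType) (x y : F) :
    x != 0 -> y != 0 ->
  (x * (x * y) - (x * (x * y))^-1) / (x - x^-1)
  = (x + x^-1) * ((x * y - (x * y)^-1) / (x - x^-1))
    - (y - y^-1) / (x - x^-1).
Proof.
move=> x0 y0; rewrite [_ * (_ / _)]mulrA -mulrBl; congr (_ / _); field.
by rewrite x0 y0.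
Qed.

Lemma qintSS (n : nat) : qint n.+2 = qint 2 * qint n.+1 - qint n.
Proof.
rewrite qint2 /qint -!exprnN -!exprnP !exprS.
by apply: qint_rec_field; rewrite ?expf_neq0 ?u_neq0.
Qed.

Lemma det_qCartanB_qint (n : nat) :
  \det (qCartanB n.+1) = qint 2 * (qint n.+1 - qint n).
Proof.
(* The recurrence has order two, so two consecutive values are carried. *)
suff [] : \det (qCartanB n.+1) = qint 2 * (qint n.+1 - qint n) /\
          \det (qCartanB n.+2) = qint 2 * (qint n.+2 - qint n.+1) by [].
elim: n => [|n [IH1 IH2]].
  split; first by rewrite det_qCartanB1 qint1 qint0 subr0 mulr1.
  by rewrite det_qCartanB_corner det_qCartanB1 det_mx00 qint1 mulrBr !mulr1.
split=> //; rewrite det_qCartanB_corner /= IH1 IH2 mul1r.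
rewrite (qintSS n.+1) {3}(qintSS n); ring.
Qed.

(** With [x = u] and [y = u^n]: the numerator [x y - y - (x y)^-1 + y^-1]
    factors as [(x - 1) (x y^2 + 1) / (x y)], and [x - 1] cancels against
    [x - x^-1 = (x - 1) (x + 1) / x]. *)
Lemma qint_diff_field (F : fieldType) (x y : F) :
    x != 0 -> y != 0 -> x - x^-1 != 0 -> x + 1 != 0 ->
  (x + x^-1) * ((x * y - (x * y)^-1) / (x - x^-1) - (y - y^-1) / (x - x^-1))
  = (x * y)^-1 * ((x ^+ 2 + 1) * (x * y ^+ 2 + 1) / (x + 1)).
Proof.
move=> x0 y0 xV xD; rewrite -mulrBl.
have dE : x - x^-1 = (x - 1) * (x + 1) / x by field.
have x1 : x - 1 != 0 by apply: contraNneq xV => x1; rewrite dE x1 !mul0r.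
by rewrite dE; field; rewrite x0 y0 xD x1.
Qed.

Lemma uD1_neq0 : u + 1 != 0.
Proof.
by apply: contra u2_neq1; rewrite addr_eq0 => /eqP ->; rewrite sqrrN expr1n.
Qed.

Theorem theorem1p6 (n : nat) (hn : (2 <= n)%N) :
  let delta := \det (qCartanB n) in
  [/\ \det (qCartanC n) = delta,
      delta = qint 2 * (qint n%:Z - qint (n%:Z - 1)) &
      delta = u ^- n * ((u ^+ 2 + 1) * (u ^+ (2 * n - 1) + 1) / (u + 1))].
Proof.
case: n hn => // n _ delta.
have deltaE : delta = qint 2 * (qint n.+1 - qint n) := det_qCartanB_qint n.
split; first exact: det_tr.
  by rewrite deltaE intS addrAC subrr add0r.
rewrite deltaE qint2 /qint -!exprnN -!exprnP.
have -> : (2 * n.+1 - 1 = (n * 2).+1)%N by rewrite mulnS mulnC addSn subn1.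
rewrite (exprS u n) (exprS u (n * 2)) exprM.
have un0 : u ^+ n != 0 by rewrite expf_neq0 ?u_neq0.
exact: qint_diff_field u_neq0 un0 u_subV_neq0 uD1_neq0.
Qed.
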